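(* For each $(d,n)\in\{(3,4),(4,12),(5,24),(6,40),(7,72),(8,126),(9,240)\}$ there exists a set $\mathcal{X}\subset\mathbb{R}^d$ of unit vectors with $|\mathcal{X}|=n$ spanning biangular lines with $A(\mathcal{X})\subseteq\{\pm1/5,\pm3/5\}$.
   Context: For a finite set $\mathcal{X}\subset\mathbb{R}^d$ of unit vectors put $A(\mathcal{X}):=\{\langle x,x'\rangle\colon x\neq x';\ x,x'\in\mathcal{X}\}$. The set $\mathcal{X}$ spans a system of biangular lines (the lines through the origin in the directions $x\in\mathcal{X}$) if $-1\notin A(\mathcal{X})$ and $|\{\gamma^2\colon\gamma\in A(\mathcal{X})\}|\leq 2$. *)

(* Defs.v *)
From HB Require Import structures.
From mathcomp Require Import all_boot all_order all_algebra.
From mathcomp Require Import finmap.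
From mathcomp Require Import reals.

Set Implicit Arguments.
Unset Strict Implicit.
Unset Printing Implicit Defensive.

Import Order.TTheory GRing.Theory Num.Theory.
Local Open Scope fset_scope.
Local Open Scope ring_scope.

Definition dot (R : realType) (d : nat) (x y : 'rV[R]_d) : R :=
  \sum_(i < d) x 0 i * y 0 i.

Definition unit_vectors (R : realType) (d : nat) (X : {fset 'rV[R]_d}) : Prop :=
  forall x, x \in X -> dot x x = 1.

Definition inner_products (R : realType) (d : nat) (X : {fset 'rV[R]_d}) :
    {fset R} :=
  [fset dot x x' | x in X, x' in X & x != x'].

Definition spans_biangular_lines (R : realType) (d : nat)
    (X : {fset 'rV[R]_d}) : Prop :=
  (-1 \notin inner_products X) /\
  (#|` [fset g ^+ 2 | g in inner_products X]| <= 2)%N.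

Lemma inner_productsP (R : realType) (d : nat) (X : {fset 'rV[R]_d}) (a : R) :
  reflect (exists x x', [/\ x \in X, x' \in X, x != x' & a = dot x x'])
          (a \in inner_products X).
Proof.
apply: (iffP (imfset2P _ _ _ _ _)) => /=.
  move=> [x xX [x' x'X ->]]; exists x, x'.
  by move: x'X; rewrite inE => /andP[].
move=> [x [x' [xX x'X ne ->]]].
by exists x => //; exists x' => //; rewrite inE x'X ne.
Qed.

(* Main.v *)
(** If [v] and [v'] are distinct roots of a root system all of whose roots have
    the same squared length [m], then [<v, v'> / m] is one of 0, ±1/2, -1, so
    the unit vectors [(2 v / sqrt m, 1) / sqrt 5] have pairwise inner products
    [(4 <v, v'> / m + 1) / 5] in {-3/5, -1/5, 1/5, 3/5}.  The dimensions
    3, ..., 9 are obtained from D2, D3, D4, D5, E6, E7 and E8, which have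
    4, 12, 24, 40, 72, 126 and 240 roots. *)

Require Import Defs.
From HB Require Import structures.
From mathcomp Require Import all_boot all_order all_algebra.
From mathcomp Require Import finmap.
From mathcomp Require Import reals.
From mathcomp Require Import lra.

Set Implicit Arguments.
Unset Strict Implicit.
Unset Printing Implicit Defensive.

Import Order.TTheory GRing.Theory Num.Theory.
Local Open Scope fset_scope.
Local Open Scope ring_scope.

Lemma biangular_of_inner_products (R : realType) (d : nat)
    (X : {fset 'rV[R]_d}) :
  inner_products X `<=` [fset 1 / 5; - (1 / 5); 3 / 5; - (3 / 5)] ->
  spans_biangular_lines X.
Proof.
move=> /fsubsetP sub; split.
  apply/negP => /sub; rewrite !inE => /orP[/orP[/orP[]|]|] /eqP; lra.
have sq : [fset g ^+ 2 | g in inner_products X]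
            `<=` [fset (1 / 5) ^+ 2; (3 / 5) ^+ 2].
  apply/fsubsetP => _ /imfsetP[g /= /sub gA ->]; move: gA; rewrite !inE.
  by case/orP=> [/orP[/orP[]|]|] /eqP ->; rewrite ?sqrrN eqxx ?orbT.
by apply: leq_trans (fsubset_leq_card sq) _; rewrite cardfs2; case: eqP.
Qed.

(* The weights are integers so that inner products are computable; square roots
   appear only in [weighted_row]. *)
Definition weighted_dot (d : nat) (w : seq nat) (u v : seq int) : int :=
  foldr +%R 0 (mkseq (fun i => (nth 0%N w i)%:Z * (u`_i * v`_i)) d).

Lemma weighted_dotC (d : nat) (w : seq nat) (u v : seq int) :
  weighted_dot d w u v = weighted_dot d w v u.
Proof.
by congr foldr; apply: eq_map => i; rewrite (mulrC u`_i).
Qed.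

Definition weighted_row (R : realType) (d : nat) (w : seq nat) (u : seq int) :
    'rV[R]_d :=
  \row_(i < d) (Num.sqrt ((nth 0%N w i)%:R / 10) * (u`_i)%:~R).

Lemma dot_weighted_row (R : realType) (d : nat) (w : seq nat) (u v : seq int) :
  dot (weighted_row R d w u) (weighted_row R d w v)
    = (weighted_dot d w u v)%:~R / 10.
Proof.
rewrite /weighted_dot foldrE big_map.
have -> : iota 0 d = index_iota 0 d by rewrite /index_iota subn0.
rewrite big_mkord rmorph_sum mulr_suml; apply: eq_bigr => i _; rewrite !mxE mulrACA.
rewrite -expr2 sqr_sqrtr ?divr_ge0 ?ler0n // !rmorphM /= -pmulrn.
by rewrite mulrAC.
Qed.

(** With squared length scaled to 10, the values ±1/5 and ±3/5 become ±2 and ±6. *)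
Definition biangular_config (d : nat) (w : seq nat) (s : seq (seq int)) : bool :=
  all (fun u => weighted_dot d w u u == 10) s
  && pairwise (fun u v => weighted_dot d w u v \in [:: 2; -2; 6; -6]) s.

Lemma biangular_configP (R : realType) (d : nat) (w : seq nat)
    (s : seq (seq int)) :
  biangular_config d w s ->
  exists X : {fset 'rV[R]_d},
    [/\ unit_vectors X,
        #|` X| = size s,
        spans_biangular_lines X
      & inner_products X `<=` [fset 1 / 5; - (1 / 5); 3 / 5; - (3 / 5)]].
Proof.
case/andP=> /allP unit_s pair_s.
pose f := weighted_row R d w.
have dot_self u : u \in s -> dot (f u) (f u) = 1.
  by move=> /unit_s/eqP; rewrite dot_weighted_row => ->; rewrite divff ?pnatr_eq0.
pose A : {fset R} := [fset 1 / 5; - (1 / 5); 3 / 5; - (3 / 5)].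
have dotA u v : weighted_dot d w u v \in [:: 2; -2; 6; -6] ->
    dot (f u) (f v) \in A.
  by rewrite dot_weighted_row !inE => /or4P[] /eqP ->;
    rewrite ?rmorphN ?mulNr -!orbA /=; apply/or4P;
    [ apply: Or41 | apply: Or42 | apply: Or43 | apply: Or44 ]; apply/eqP; lra.
have oneA : 1 \notin A.
  by rewrite !inE; apply/negP => /orP[/orP[/orP[]|]|] /eqP; lra.
(* [pairwise] only compares earlier entries with later ones; allowing equality makes [r] reflexive
   as well as symmetric, so it extends to all pairs. *)
pose r u v := (u == v) || (weighted_dot d w u v \in [:: 2; -2; 6; -6]).
have r_s : {in s &, forall u v, r u v}.
  apply/allrelP; rewrite -pairwise_all2rel.
  - by apply: sub_pairwise pair_s => u v; rewrite /r => ->; rewrite orbT.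
  - by move=> u; rewrite /r eqxx.
  - by move=> u v; rewrite /r eq_sym weighted_dotC.
(* Vectors with the same image have inner product 1, which [A] excludes. *)
have f_inj : {in s &, injective f}.
  move=> u v us vs fuv; have /orP[/eqP //|/dotA] := r_s u v us vs.
  by rewrite -fuv dot_self // (negPf oneA).
have uniq_s : uniq s.
  rewrite uniq_pairwise; apply: sub_in_pairwise (allss s) pair_s => u v us vs /=.
  by move=> /dotA; apply: contraTneq => <-; rewrite dot_self.
pose X := [fset x in map f s].
have subA : inner_products X `<=` A.
  apply/fsubsetP => _ /inner_productsP[x [y [xX yX xy ->]]].
  rewrite !inE /= in xX yX; case/mapP: xX xy => u us ->.
  case/mapP: yX => v vs -> uv.
  have /orP[/eqP uv_eq|/dotA //] := r_s u v us vs.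
  by rewrite uv_eq eqxx in uv.
exists X; split=> //.
- by move=> x; rewrite inE /= => /mapP[u us ->]; apply: dot_self.
- by rewrite card_fseq undup_id ?size_map // map_inj_in_uniq.
- exact: biangular_of_inner_products.
Qed.

(** A zero entry is not signed twice, as duplicates would fail the pairwise test. *)
Fixpoint signings (u : seq int) : seq (seq int) :=
  if u is a :: u' then
    let t := signings u' in
    if a == 0 then map (cons 0) t else map (cons a) t ++ map (cons (- a)) t
  else [:: [::]].

Definition all_signings (supports : seq (seq int)) : seq (seq int) :=
  flatten (map signings supports).

Definition roots_D (k : nat) : seq (seq int) :=
  all_signings (permutations ([:: 1; 1] ++ nseq (k - 2) 0)).

(* The last coordinate carries weight 3, i.e. it stands for a multiple of
   [sqrt 3]: E6 has no rational orthogonal coordinates in dimension 6. *)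
Definition roots_E6 : seq (seq int) :=
  map (fun u => rcons u 0)
      (all_signings (permutations [:: 2; 2; 0; 0; 0]))
  (* The sixth sign is the product of the other five, giving 32 vectors besides the 40 roots of
     D5. *)
  ++ [seq u <- signings (nseq 6 1) | foldr *%R 1 u == 1].

(* The rotations of [1110100] are the complements of the lines of the Fano
   plane, i.e. the nonzero words of the [7,3,4] simplex code; with the lines
   extended by a further point they are the words of weight 4 of the extended
   [8,4,4] Hamming code. *)
Definition fano_complements : seq (seq int) :=
  [seq rot i [:: 1; 1; 1; 0; 1; 0; 0] | i <- iota 0 7].

Definition fano_lines : seq (seq int) :=
  [seq rot i [:: 0; 0; 0; 1; 0; 1; 1] | i <- iota 0 7].

(** Construction A: the minimal vectors among integer vectors that reduce mod 2 to a codeword. *)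
Definition roots_E7 : seq (seq int) :=
  all_signings (permutations (2 :: nseq 6 0) ++ fano_complements).

Definition roots_E8 : seq (seq int) :=
  all_signings (permutations (2 :: nseq 7 0)
                ++ map (cons 0) fano_complements ++ map (cons 1) fano_lines).

(** The weights give every root squared length 8 and the new coordinate 2, so root products 4, 0,
    -4, -8 become 6, 2, -2, -6. *)
Definition lift_roots (s : seq (seq int)) : seq (seq int) := map (cons 1) s.

Lemma biangular_D2 : biangular_config 3 [:: 2; 4; 4]%N (lift_roots (roots_D 2)).
Proof. by vm_compute. Qed.

Lemma biangular_D3 : biangular_config 4 (2 :: nseq 3 4)%N (lift_roots (roots_D 3)).
Proof. by vm_compute. Qed.

Lemma biangular_D4 : biangular_config 5 (2 :: nseq 4 4)%N (lift_roots (roots_D 4)).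
Proof. by vm_compute. Qed.

Lemma biangular_D5 : biangular_config 6 (2 :: nseq 5 4)%N (lift_roots (roots_D 5)).
Proof. by vm_compute. Qed.

Lemma biangular_E6 :
  biangular_config 7 [:: 2; 1; 1; 1; 1; 1; 3]%N (lift_roots roots_E6).
Proof. by vm_compute. Qed.

Lemma biangular_E7 : biangular_config 8 (nseq 8 2)%N (lift_roots roots_E7).
Proof. by vm_compute. Qed.

Lemma biangular_E8 : biangular_config 9 (nseq 9 2)%N (lift_roots roots_E8).
Proof. by vm_compute. Qed.

Theorem corollary2p10 (R : realType) (d n : nat)
    (hdn : (d, n) \in [:: (3, 4); (4, 12); (5, 24); (6, 40); (7, 72);
                          (8, 126); (9, 240)]%N) :
  exists X : {fset 'rV[R]_d},
    [/\ unit_vectors X,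
        #|` X| = n,
        spans_biangular_lines X
      & inner_products X `<=` [fset 1 / 5; - (1 / 5); 3 / 5; - (3 / 5)]].
Proof.
have realize w s : biangular_config d w s -> size s = n ->
    exists X : {fset 'rV[R]_d},
    [/\ unit_vectors X, #|` X| = n, spans_biangular_lines X
      & inner_products X `<=` [fset 1 / 5; - (1 / 5); 3 / 5; - (3 / 5)]].
  by move=> /(biangular_configP R) H <-.
move: hdn; rewrite !inE => hdn.
case/or4P: hdn realize => [|||/or4P[]] /eqP[-> ->] realize.
- by apply: realize biangular_D2 _; vm_compute.
- by apply: realize biangular_D3 _; vm_compute.
- by apply: realize biangular_D4 _; vm_compute.
- by apply: realize biangular_D5 _; vm_compute.
- by apply: realize biangular_E6 _; vm_compute.
- by apply: realize biangular_E7 _; vm_compute.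
- by apply: realize biangular_E8 _; vm_compute.
Qed.
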